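(* Let $p$ be a prime and let $q=p^m$ for some integer $m \ge 1$. In a triangle $ABC$, from each vertex draw the $q-1$ cevians that divide the opposite side into $q$ pieces of equal length. Then: (a) if $p$ is odd, the number of triangles formed is $(8q^3-9q^2+3q)/2$; (b) if $p=2$, the number of triangles formed is $(8q^3-9q^2-3q+10)/2$.
   Context: A cevian of triangle $ABC$ is a line segment joining a vertex of the triangle to a point in the interior of the opposite side. A ''triangle formed'' in the figure (the three sides of $ABC$ together with all $3(q-1)$ cevians) means a triangle whose three sides each lie along one of the drawn segments, with vertices at intersection points of these segments; triangles may be unions of smaller regions. *)

(* Defs.v *)
From mathcomp Require Export all_boot all_order all_algebra.
From mathcomp Require Export classical_sets cardinality reals.
Set Implicit Arguments.
Unset Strict Implicit.
Unset Printing Implicit Defensive.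
Export GRing.Theory Num.Theory.
Global Open Scope classical_set_scope.
Global Open Scope card_scope.
Global Open Scope ring_scope.

Definition noncollinear (R : realType) (P Q S : 'rV[R]_2) : bool :=
  free [:: Q - P; S - P].

Definition segment (R : realType) (P Q : 'rV[R]_2) : set 'rV[R]_2 :=
  [set (1 - t) *: P + t *: Q | t in [set t : R | 0 <= t <= 1]].

(* The k-th of the points cutting [P, Q] into q pieces of equal length. *)
Definition division_point (R : realType) (q : nat) (P Q : 'rV[R]_2) (k : nat)
    : 'rV[R]_2 :=
  P + (k%:R / q%:R) *: (Q - P).

Definition cevians (R : realType) (q : nat) (V P Q : 'rV[R]_2)
    : set (set 'rV[R]_2) :=
  [set segment V (division_point q P Q k) | k in [set k : nat | (0 < k < q)%N]].

Definition drawn_segments (R : realType) (q : nat) (A B C : 'rV[R]_2)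
    : set (set 'rV[R]_2) :=
  [set segment A B; segment B C; segment C A] `|`
  (cevians q A B C `|` cevians q B C A `|` cevians q C A B).

Definition bounds_triangle (R : realType) (a b c : set 'rV[R]_2)
    (P Q S : 'rV[R]_2) : Prop :=
  [/\ noncollinear P Q S,
      [/\ b `&` c = [set P], c `&` a = [set Q] & a `&` b = [set S]] &
      [/\ segment Q S `<=` a, segment S P `<=` b & segment P Q `<=` c]].

(* A triangle is represented by its set of vertices, so that triangles are
   counted as geometric figures, without order on the vertices. *)
Definition triangles_formed (R : realType) (q : nat) (A B C : 'rV[R]_2)
    : set (set 'rV[R]_2) :=
  [set T | exists a b c P Q S,
     [/\ [/\ drawn_segments q A B C a, drawn_segments q A B C b &
             drawn_segments q A B C c],
         bounds_triangle a b c P Q S & T = [set P; Q; S]]].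

(* Main.v *)
Require Import Defs.
From mathcomp Require Import boolp zify ring lra.
Import Order.TTheory.

Set Implicit Arguments.
Unset Strict Implicit.
Unset Printing Implicit Defensive.

(** Sides and cevians together are [3 q] segments, any two of which meet in
exactly one point. A triangle is therefore a set of three of them without a
common point, and it determines this set. Three of the segments have a common
point when they belong to the [q + 1] segments through a vertex, or when they
are cevians from the three vertices whose indices [i], [j], [k] satisfy Ceva's
condition [i j k = (q - i) (q - j) (q - k)]. So the number of triangles is
[C(3 q, 3) - 3 C(q + 1, 3) - N], where [N] is the number of solutions of
Ceva's condition. For [q = p ^ m] a divisibility argument shows that a solution
exists only if [p = 2], and that then one of [i], [j], [k] is [q / 2] and the
other two add up to [q]; hence [N = 3 q - 5] for [p = 2]. *)

(** * Ceva's condition *)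

(** Take [p ^ a] to be the full power of [p] in [i]. Since [i < p ^ m], the exponent [a] is below
    [m], so [p ^ a] also divides [p ^ m - i]. The remaining exponent [m - a] is positive, hence its
    form [s.+1]. *)
Lemma pfactor_part (p m i : nat) : prime p -> (0 < i < p ^ m)%N ->
  exists a s u v, [/\ (i = p ^ a * u)%N, (p ^ m - i = p ^ a * v)%N,
    (p ^ m = p ^ a * p ^ s.+1)%N, (u + v = p ^ s.+1)%N & coprime p u].
Proof.
move=> p_pr /andP[i_gt0 lt_i].
have [u cop_pu def_i] := pfactor_coprime p_pr i_gt0.
have p_gt0 := prime_gt0 p_pr.
move: (logn p i) def_i => a def_i.
have u_gt0 : (0 < u)%N by move: i_gt0; rewrite def_i muln_gt0 => /andP[].
have lt_am : (a < m)%N.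
  rewrite -(ltn_exp2l _ _ (prime_gt1 p_pr)); apply: leq_ltn_trans lt_i.
  by rewrite def_i leq_pmull.
have def_q : (p ^ m = p ^ a * p ^ (m - a.+1).+1)%N.
  by rewrite -expnD; congr (_ ^ _)%N; lia.
exists a, (m - a.+1)%N, u, (p ^ (m - a.+1).+1 - u)%N; split => //.
- by rewrite mulnC.
- by rewrite {1}def_q {1}def_i mulnBr [(u * _)%N]mulnC.
- rewrite subnKC // ltnW //; move: lt_i.
  by rewrite def_q {1}def_i mulnC ltn_pmul2l ?expn_gt0 ?p_gt0.
Qed.

(* Reducing [i / (q - i)] to [u / v], the sum [u + v] is a power of [p]. Modulo
   the smallest of the three sums the product equation reads
   [u1 u2 u3 = - u1 u2 u3], so this sum divides [2]. *)
Lemma ceva_min_half (p a s1 s2 s3 u1 v1 u2 v2 u3 v3 : nat) : prime p ->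
  (s1 <= s2)%N -> (s1 <= s3)%N ->
  (u1 + v1 = p ^ s1.+1)%N -> (u2 + v2 = p ^ s2.+1)%N ->
  (u3 + v3 = p ^ s3.+1)%N ->
  coprime p u1 -> coprime p u2 -> coprime p u3 ->
  (u1 * u2 * u3 = v1 * v2 * v3)%N ->
  p = 2%N /\ (2 * (p ^ a * u1) = p ^ a * p ^ s1.+1)%N.
Proof.
move=> p_pr le12 le13 sum1 sum2 sum3 cop1 cop2 cop3 eq_uv.
have dvd_sum s u v : (s1 <= s)%N -> (u + v = p ^ s.+1)%N ->
    (p ^ s1.+1 %| u + v)%N by move=> ? ->; rewrite dvdn_exp2l.
have : (p ^ s1.+1 %| u1 * u2 * u3 + v1 * v2 * v3)%N.
  (* Replacing [u1], [u2], [u3] by [- v1], [- v2], [- v3] one at a time, without negative numbers: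
     once this multiple is added, the sum splits into multiples of [u1 + v1] and [u2 + v2]. *)
  have dvd3 : (p ^ s1.+1 %| v1 * u2 * (u3 + v3))%N.
    by rewrite dvdn_mull // (dvd_sum s3).
  rewrite -(dvdn_addl _ dvd3).
  have -> : (u1 * u2 * u3 + v1 * v2 * v3 + v1 * u2 * (u3 + v3) =
    (u2 * u3) * (u1 + v1) + (v1 * v3) * (u2 + v2))%N by lia.
  by rewrite dvdn_add // dvdn_mull //; [apply: (dvd_sum s1)|apply: (dvd_sum s2)].
(* The sum is now twice [u1 * u2 * u3], which is prime to [p], so [p ^ s1.+1] divides [2]. This
   forces [p = 2] and [s1 = 0], and then [u1 + v1 = 2] with [u1] odd. *)
rewrite -eq_uv addnn -mul2n Gauss_dvdl; last first.
  by rewrite coprimeXl // !coprimeMr cop1 cop2 cop3.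
move=> dvd2.
have p2 : p = 2%N.
  by apply/eqP; rewrite -dvdn_prime2 // (dvdn_trans _ dvd2) // dvdn_exp.
have s10 : s1 = 0%N.
  by have := dvdn_leq (ltn0Sn 1) dvd2; rewrite p2 -{2}(expn1 2) leq_exp2l //
    ltnS leqn0 => /eqP.
move: sum1 cop1; rewrite p2 s10 coprime2n => sum1 odd1; split => //.
have -> : u1 = 1%N by lia.
by rewrite muln1 mulnC.
Qed.

(** Both sides of Ceva's condition carry the same power [p ^ (a1 + a2 + a3)], which cancels. The
    reduced equation is symmetric, so the index with the smallest exponent can be moved to the
    front. *)
Lemma ceva_half (p m i j k : nat) : prime p -> (0 < i < p ^ m)%N ->
  (0 < j < p ^ m)%N -> (0 < k < p ^ m)%N ->
  (i * j * k = (p ^ m - i) * (p ^ m - j) * (p ^ m - k))%N ->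
  p = 2%N /\ [\/ (2 * i = p ^ m)%N, (2 * j = p ^ m)%N | (2 * k = p ^ m)%N].
Proof.
move=> p_pr /(pfactor_part p_pr)[a1 [s1 [u1 [v1 [di dqi dq1 sum1 cop1]]]]].
move=> /(pfactor_part p_pr)[a2 [s2 [u2 [v2 [dj dqj dq2 sum2 cop2]]]]].
move=> /(pfactor_part p_pr)[a3 [s3 [u3 [v3 [dk dqk dq3 sum3 cop3]]]]].
rewrite dqi dqj dqk di dj dk.
have regroup x y z : (p ^ a1 * x * (p ^ a2 * y) * (p ^ a3 * z) =
  p ^ (a1 + a2 + a3) * (x * y * z))%N by rewrite !expnD; lia.
rewrite !regroup => /eqP.
rewrite eqn_pmul2l ?expn_gt0 ?prime_gt0 // => /eqP eq_uv.
have eq_uv2 : (u2 * u1 * u3 = v2 * v1 * v3)%N.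
  by rewrite (mulnC u2) (mulnC v2).
have eq_uv3 : (u3 * u1 * u2 = v3 * v1 * v2)%N.
  by rewrite -!(mulnA _ _ (_ : nat)) !(mulnC _ (_ * _)%N).
have [[le12 le13]|[[le21 le23]|[le31 le32]]] :
    (s1 <= s2)%N /\ (s1 <= s3)%N \/ (s2 <= s1)%N /\ (s2 <= s3)%N \/
    (s3 <= s1)%N /\ (s3 <= s2)%N by lia.
- have [? e] := ceva_min_half a1 p_pr le12 le13 sum1 sum2 sum3 cop1 cop2 cop3
    eq_uv.
  by split => //; constructor 1; rewrite e.
- have [? e] := ceva_min_half a2 p_pr le21 le23 sum2 sum1 sum3 cop2 cop1 cop3
    eq_uv2.
  by split => //; constructor 2; rewrite e.
- have [? e] := ceva_min_half a3 p_pr le31 le32 sum3 sum1 sum2 cop3 cop1 cop2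
    eq_uv3.
  by split => //; constructor 3; rewrite e.
Qed.

(** * Counting the solutions of Ceva's condition *)

Definition ceva_triples (q : nat) : {set 'I_q * 'I_q * 'I_q} :=
  [set t : 'I_q * 'I_q * 'I_q | (t.1.1 * t.1.2 * t.2 ==
            (q - t.1.1) * (q - t.1.2) * (q - t.2) :> nat)%N]%SET.

(** Indices stay below [q], so the product of complements is positive. Hence the index [0], which
    stands for a side, never occurs in a solution. *)
Lemma ceva_triple_gt0 q (t : 'I_q * 'I_q * 'I_q) : t \in ceva_triples q ->
  [/\ (0 < t.1.1)%N, (0 < t.1.2)%N & (0 < t.2)%N].
Proof.
rewrite inE => /eqP e.
have : (0 < t.1.1 * t.1.2 * t.2)%N by rewrite e !muln_gt0 !subn_gt0 !ltn_ord.
by rewrite !muln_gt0 => /andP[/andP[-> ->] ->].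
Qed.

Lemma card_ceva_odd p m : prime p -> odd p -> #|ceva_triples (p ^ m)| = 0%N.
Proof.
move=> p_pr p_odd; apply/eqP; rewrite cards_eq0; apply/eqP/setP => t.
rewrite [RHS]inE; apply/negP => t_ceva.
have [gt1 gt2 gt3] := ceva_triple_gt0 t_ceva.
move: t_ceva; rewrite inE => /eqP.
by case/ceva_half; rewrite ?gt1 ?gt2 ?gt3 ?ltn_ord // => p2 _; rewrite p2 in p_odd.
Qed.

Lemma complement_of_mul_eq (q j k : nat) : (j < q)%N -> (k < q)%N ->
  (j * k = (q - j) * (q - k))%N -> (j + k = q)%N.
Proof.
move=> lt_j lt_k; have := subnKC (ltnW lt_j); have := subnKC (ltnW lt_k).
move: (q - j)%N (q - k)%N => c d qk qj e.
(* With [c] and [d] the complements of [j] and [k], the hypothesis [j * k = c * d] makes this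
   identity hold. It reads [(j + k) * q = q * q]. *)
have : (j * (k + d) + k * (j + c) = (j + c) * (k + d))%N by nia.
rewrite qk qj -mulnDl => /eqP.
by rewrite eqn_pmul2r ?(leq_ltn_trans _ lt_k) // => /eqP.
Qed.

(** An index equal to [q / 2] is its own complement and cancels from the equation. The other two
    then satisfy the two-factor condition, which makes them complementary. *)
Lemma ceva_two (m : nat) (t : 'I_(2 ^ m) * 'I_(2 ^ m) * 'I_(2 ^ m)) :
  t \in ceva_triples (2 ^ m) =
  [|| (2 * t.1.1 == 2 ^ m) && (t.1.2 + t.2 == 2 ^ m),
      (2 * t.1.2 == 2 ^ m) && (t.1.1 + t.2 == 2 ^ m) |
      (2 * t.2 == 2 ^ m) && (t.1.1 + t.1.2 == 2 ^ m)]%N.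
Proof.
have := ltn_ord t.1.1; have := ltn_ord t.1.2; have := ltn_ord t.2.
move=> lt3 lt2 lt1.
apply/idP/idP => [t_ceva|].
  have [gt1 gt2 gt3] := ceva_triple_gt0 t_ceva.
  move: t_ceva; rewrite inE => /eqP e.
  have [] := @ceva_half 2 m _ _ _ isT _ _ _ e; rewrite ?gt1 ?gt2 ?gt3 //.
  move: e lt1 lt2 lt3; move: (2 ^ m)%N (nat_of_ord t.1.1) (nat_of_ord t.1.2)
    (nat_of_ord t.2) gt1 gt2 gt3 => q i j k i0 j0 k0 e lt1 lt2 lt3 _ [] h.
  - have qi : (q - i = i)%N by lia.
    rewrite h eqxx; apply/or3P; constructor 1; apply/eqP; move/eqP: e.
    rewrite qi -!mulnA eqn_pmul2l // => /eqP; exact: complement_of_mul_eq.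
  - have qj : (q - j = j)%N by lia.
    rewrite h eqxx; apply/or3P; constructor 2; apply/eqP; move/eqP: e.
    rewrite qj !(mulnC _ j) -!mulnA eqn_pmul2l // => /eqP.
    exact: complement_of_mul_eq.
  - have qk : (q - k = k)%N by lia.
    rewrite h eqxx; apply/or3P; constructor 3; apply/eqP; move/eqP: e.
    rewrite qk eqn_pmul2r // => /eqP; exact: complement_of_mul_eq.
rewrite inE; move: lt1 lt2 lt3; move: (2 ^ m)%N (nat_of_ord t.1.1)
  (nat_of_ord t.1.2) (nat_of_ord t.2) => q i j k lt1 lt2 lt3.
case/or3P => /andP[/eqP h /eqP e]; apply/eqP.
- have [-> -> ->] : [/\ q - i = i, q - j = k & q - k = j]%N by split; lia.
  by ring.
- have [-> -> ->] : [/\ q - i = k, q - j = j & q - k = i]%N by split; lia.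
  by ring.
- have [-> -> ->] : [/\ q - i = j, q - j = i & q - k = k]%N by split; lia.
  by ring.
Qed.

(** Each choice of the index equal to [q / 2] gives [q - 1] triples. The triple with all indices
    [q / 2] is the only overlap and belongs to all three families, so the union has [3 (q - 1) - 2]
    elements. *)
Lemma card_ceva_two m : (0 < m)%N ->
  #|ceva_triples (2 ^ m)| = (3 * 2 ^ m - 5)%N.
Proof.
case: m => // m _; have := @ceva_two m.+1.
have h_gt0 : (0 < 2 ^ m)%N by rewrite expn_gt0.
rewrite expnS; move: (2 ^ m)%N h_gt0 => h h_gt0.
have [n def_q] : exists n, (2 * h = n.+1)%N by exists (2 * h).-1; lia.
rewrite def_q => cevaE.
pose i0 : 'I_n.+1 := inord h.
have hE : i0 = h :> nat by rewrite inordK //; lia.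
(* At [j = 0] the complement is out of range and [inord] returns its default, so [opp] is used only
   on nonzero indices. *)
pose opp (j : 'I_n.+1) : 'I_n.+1 := inord (n.+1 - j).
have oppE (j : 'I_n.+1) : j != ord0 -> opp j = (n.+1 - j)%N :> nat.
  by move=> j0; rewrite inordK //; have : j != 0%N :> nat by []; lia.
have gt0 (j : 'I_n.+1) : (j != ord0) = (0 < j)%N by rewrite lt0n.
pose A1 := [set t : 'I_n.+1 * 'I_n.+1 * 'I_n.+1 |
  (2 * t.1.1 == n.+1) && (t.1.2 + t.2 == n.+1)]%N%SET.
pose A2 := [set t : 'I_n.+1 * 'I_n.+1 * 'I_n.+1 |
  (2 * t.1.2 == n.+1) && (t.1.1 + t.2 == n.+1)]%N%SET.
pose A3 := [set t : 'I_n.+1 * 'I_n.+1 * 'I_n.+1 |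
  (2 * t.2 == n.+1) && (t.1.1 + t.1.2 == n.+1)]%N%SET.
have card_n0 : #|[set~ (ord0 : 'I_n.+1)]%SET| = n by rewrite cardsC1 card_ord.
have cA1 : #|A1| = n.
  have -> : A1 = [set (i0, j, opp j) | j in [set~ ord0]]%SET.
    apply/setP => -[[i j] k]; rewrite inE /=; apply/andP/imsetP.
      move=> [/eqP ei /eqP ejk].
      have j0 : j != ord0 by rewrite gt0; have := ltn_ord k; lia.
      exists j; first by rewrite !inE.
      by congr (_, _, _); apply/val_inj; rewrite /= ?oppE ?hE //; lia.
    move=> [j']; rewrite !inE => j0 [-> -> ->].
    by rewrite oppE // hE; have := ltn_ord j'; split; apply/eqP; lia.
  by rewrite card_imset // => j j' [].
have cA2 : #|A2| = n.
  have -> : A2 = [set (j, i0, opp j) | j in [set~ ord0]]%SET.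
    apply/setP => -[[i j] k]; rewrite inE /=; apply/andP/imsetP.
      move=> [/eqP ei /eqP ejk].
      have j0 : i != ord0 by rewrite gt0; have := ltn_ord k; lia.
      exists i; first by rewrite !inE.
      by congr (_, _, _); apply/val_inj; rewrite /= ?oppE ?hE //; lia.
    move=> [j']; rewrite !inE => j0 [-> -> ->].
    by rewrite oppE // hE; have := ltn_ord j'; split; apply/eqP; lia.
  by rewrite card_imset // => j j' [].
have cA3 : #|A3| = n.
  have -> : A3 = [set (j, opp j, i0) | j in [set~ ord0]]%SET.
    apply/setP => -[[i j] k]; rewrite inE /=; apply/andP/imsetP.
      move=> [/eqP ei /eqP ejk].
      have j0 : i != ord0 by rewrite gt0; have := ltn_ord j; lia.
      exists i; first by rewrite !inE.
      by congr (_, _, _); apply/val_inj; rewrite /= ?oppE ?hE //; lia.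
    move=> [j']; rewrite !inE => j0 [-> -> ->].
    by rewrite oppE // hE; have := ltn_ord j'; split; apply/eqP; lia.
  by rewrite card_imset // => j j' [].
have -> : ceva_triples n.+1 = (A1 :|: A2 :|: A3)%SET.
  by apply/setP => t; rewrite cevaE !inE orbA.
have memP (t : 'I_n.+1 * 'I_n.+1 * 'I_n.+1) :
  (t == (i0, i0, i0)) = [&& t.1.1 == h :> nat, t.1.2 == h :> nat & t.2 == h :> nat].
  by case: t => [[i j] k]; rewrite -hE !xpair_eqE -andbA.
have I12 : (A1 :&: A2 = [set (i0, i0, i0)])%SET.
  by apply/setP => t; rewrite !inE memP; lia.
have I3 : ((A1 :|: A2) :&: A3 = [set (i0, i0, i0)])%SET.
  by apply/setP => t; rewrite !inE memP; lia.
by rewrite cardsU I3 cardsU I12 !cards1 cA1 cA2 cA3; lia.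
Qed.

(** * Incidence in barycentric coordinates *)

(* [(v, k)] stands for the segment from the vertex [v] to the [k]-th division
   point of the side from [v + 1] to [v - 1], indices of vertices being modulo
   [3]. The case [k = 0] is the side from [v] to [v + 1]; the value [k = q] is
   excluded since it would list the sides twice. *)
Notation segment_index q := ('I_3 * 'I_q)%type.

Section Incidence.
Variables (R : realType) (q : nat).
Implicit Types (s t u : segment_index q) (x y z : 'rV[R]_3) (v w : 'I_3).

(* Points of the triangle are given by barycentric coordinates; the line of the
   segment [s] has the equation [lform s x = 0]. *)
Definition simplex x := (forall v, 0 <= x 0 v) /\ \sum_v x 0 v = 1.

Definition lform s x : R :=
  s.2%:R * x 0 (s.1 + 1) - (q%:R - s.2%:R) * x 0 (s.1 - 1).

Definition incident s x := simplex x /\ lform s x = 0.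

Lemma lformD s x y : lform s (x + y) = lform s x + lform s y.
Proof. by rewrite /lform !mxE; ring. Qed.

Lemma lformZ s a x : lform s (a *: x) = a * lform s x.
Proof. by rewrite /lform !mxE; ring. Qed.

Lemma lformB s x y : lform s (x - y) = lform s x - lform s y.
Proof. by rewrite /lform !mxE; ring. Qed.

Lemma ord3_cases v w : [\/ w = v, w = v + 1 | w = v - 1].
Proof.
case: v w => [[|[|[|//]]] ?] [[|[|[|//]]] ?];
  by [constructor 1; apply/val_inj|constructor 2; apply/val_inj|
      constructor 3; apply/val_inj].
Qed.

Lemma ord3_add2 v : v + 1 + 1 = v - 1.
Proof. by apply/val_inj; case: v => [[|[|[|//]]] ?]. Qed.

Lemma ord3_sub2 v : v - 1 - 1 = v + 1.
Proof. by apply/val_inj; case: v => [[|[|[|//]]] ?]. Qed.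

Lemma ord3_neq v : [/\ v + 1 == v = false, v - 1 == v = false &
  v + 1 == v - 1 = false].
Proof. by case: v => [[|[|[|//]]] ?]. Qed.

Lemma sum_ord3 (V : nmodType) (F : 'I_3 -> V) v :
  \sum_w F w = F v + F (v + 1) + F (v - 1).
Proof.
rewrite (bigD1 v) //= (bigD1 (v + 1)) /=; last by have [->] := ord3_neq v.
rewrite (bigD1 (v - 1)) /=; last by have [_ -> h] := ord3_neq v; rewrite eq_sym h.
rewrite big1 ?addr0 ?addrA // => w.
by case: (ord3_cases v w) => ->; rewrite eqxx ?andbF.
Qed.

Lemma sum_row3 v x : \sum_w x 0 w = x 0 v + x 0 (v + 1) + x 0 (v - 1).
Proof. exact: sum_ord3. Qed.

Lemma row3P v x y : x 0 v = y 0 v -> x 0 (v + 1) = y 0 (v + 1) ->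
  x 0 (v - 1) = y 0 (v - 1) -> x = y.
Proof. by move=> *; apply/rowP => w; case: (ord3_cases v w) => ->. Qed.

Definition vertex v : 'rV[R]_3 := delta_mx 0 v.

Lemma simplex_vertex v : simplex (vertex v).
Proof.
split=> [w|]; first by rewrite mxE ler0n.
by have [h1 h2 _] := ord3_neq v; rewrite (sum_row3 v (vertex v)) !mxE !eqxx h1 h2 !addr0.
Qed.

Lemma ltr_index s : 0 < q%:R - s.2%:R :> R.
Proof. by rewrite subr_gt0 ltr_nat. Qed.

Lemma index_ge0 s : 0 <= s.2%:R :> R. Proof. exact: ler0n. Qed.

(** Besides the segments starting at [v], only the side from [v - 1], which has index [0], reaches
    [v], because the index [q] is excluded. *)
Lemma incident_vertex v s : incident s (vertex v) <->
  s.1 = v \/ s.1 = v - 1 /\ s.2 = 0%N :> nat.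
Proof.
have lt_s := ltr_index s; have [n1 n2 n3] := ord3_neq s.1.
have gt0 : q%:R - s.2%:R != 0 :> R by rewrite gt_eqF.
rewrite /incident /lform /vertex !mxE !eqxx /=; split.
  case=> _; case: (ord3_cases s.1 v) => ->.
  - by left.
  - rewrite eqxx [_ - 1 == _]eq_sym n3 mulr1 mulr0 subr0 => /eqP.
    by rewrite pnatr_eq0 => /eqP e; right; rewrite addrK.
  - by rewrite eqxx n3 mulr1 mulr0 sub0r => /eqP; rewrite oppr_eq0 (negPf gt0).
case=> [<-|[e2 e1]]; split; try exact: simplex_vertex.
  by rewrite n1 n2 !mulr0 subr0.
have -> : v = s.1 + 1 by rewrite e2 subrK.
by rewrite e1 mul0r [_ - 1 == _]eq_sym n3 mulr0 subr0.
Qed.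

(** Subtracting the two equations leaves the difference of the indices times the sum of the two
    coordinates away from the common vertex. That sum vanishes, and by nonnegativity so does each
    coordinate. *)
Lemma incident_same s t x : s.1 = t.1 -> s <> t -> incident s x ->
  incident t x -> x = vertex s.1.
Proof.
case: s t => [v k] [w j] /= <- neq [[x_ge0 sumx]] + [_].
rewrite /lform /= => e1 e2.
have lt_k := ltr_index (v, k); have lt_j := ltr_index (v, j); rewrite /= in lt_k lt_j.
have e3 : (k%:R - j%:R) * (x 0 (v + 1) + x 0 (v - 1)) = 0.
  by rewrite -[RHS](subrr 0) -{1}e1 -e2; ring.
have /eqP e4 : x 0 (v + 1) + x 0 (v - 1) == 0.
  move/eqP: e3; rewrite mulf_eq0 subr_eq0 eqr_nat => /orP[/eqP/val_inj e|//].
  by case: neq; rewrite e.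
have := x_ge0 (v + 1); have := x_ge0 (v - 1) => h1 h2.
move: sumx; rewrite (sum_row3 v x) => sumx.
have [h3 h4] : x 0 (v + 1) = 0 /\ x 0 (v - 1) = 0 by lra.
have [n1 n2 _] := ord3_neq v.
by apply: (@row3P v); rewrite !mxE !eqxx /= ?n1 ?n2 ?h3 ?h4 //; lra.
Qed.

(* On two segments from the vertices [v] and [v + 1] the coordinates [v - 1] and
   [v] are nonnegative multiples of the coordinate [v + 1]. *)
Lemma incident_next s t x y : t.1 = s.1 + 1 -> incident s x -> incident t x ->
  incident s y -> incident t y -> x = y.
Proof.
case: s t => [v k] [w j] /= ->.
rewrite /incident /lform /simplex /= (sum_row3 v x) (sum_row3 v y) addrK ord3_add2.
move=> [[x_ge0 sx] ex1] [_ ex2] [[y_ge0 sy] ey1] [_ ey2].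
have lt_k := ltr_index (v, k); have lt_j := ltr_index (v, j).
rewrite /= in lt_k lt_j.
have := index_ge0 (v, k); have := index_ge0 (v, j) => /= j_ge0 k_ge0.
move: (k%:R : R) (j%:R : R) (q%:R : R) lt_k lt_j j_ge0 k_ge0 ex1 ex2 ey1 ey2.
move=> K J Q lt_k lt_j J0 K0 ex1 ex2 ey1 ey2.
pose a := K / (Q - K); pose b := J / (Q - J) * a.
have a_ge0 : 0 <= a by rewrite divr_ge0 // ltW.
have b_ge0 : 0 <= b by rewrite mulr_ge0 // divr_ge0 // ltW.
have quot (c d g h : R) : 0 < d -> c * g - d * h = 0 -> h = c / d * g.
  move=> d_gt0 /eqP; rewrite subr_eq0 => /eqP e.
  by rewrite mulrAC e mulrAC divff ?mul1r // gt_eqF.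
have coord z : K * z 0 (v + 1) - (Q - K) * z 0 (v - 1) = 0 ->
    J * z 0 (v - 1) - (Q - J) * z 0 v = 0 ->
    z 0 (v - 1) = a * z 0 (v + 1) /\ z 0 v = b * z 0 (v + 1).
  move=> /(quot _ _ _ _ lt_k) h1 /(quot _ _ _ _ lt_j) h2.
  by split; rewrite // /b -mulrA -h1.
have [hx1 hx2] := coord _ ex1 ex2; have [hy1 hy2] := coord _ ey1 ey2.
have e : x 0 (v + 1) = y 0 (v + 1).
  (* The coordinates of each point add up to [1], so the coordinate [v + 1] times the positive
     number [b + 1 + a] is [1] for both points. *)
  have : (b + 1 + a) * (x 0 (v + 1) - y 0 (v + 1)) = 0.
    rewrite hx1 hx2 in sx; rewrite hy1 hy2 in sy.
    by rewrite mulrBr !mulrDl !mul1r sx sy subrr.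
  move/eqP; rewrite mulf_eq0 subr_eq0 gt_eqF /= => [/eqP //|].
  by rewrite ltr_wpDr // ltr_wpDl.
by apply: (@row3P v); rewrite ?hx1 ?hx2 ?hy1 ?hy2 ?e.
Qed.

Lemma incident_unique s t x y : s <> t -> incident s x -> incident t x ->
  incident s y -> incident t y -> x = y.
Proof.
move=> neq sx tx sy ty; case: (ord3_cases s.1 t.1) => e.
- by rewrite (incident_same (esym e) neq sx tx) (incident_same (esym e) neq sy ty).
- exact: (incident_next e).
- by apply: (incident_next (s := t) (t := s)); rewrite ?e ?subrK.
Qed.

Lemma incident_exists_next s t : t.1 = s.1 + 1 ->
  exists2 x, incident s x & incident t x.
Proof.
case: s t => [v k] [w j] /= ->.
have lt_k := ltr_index (v, k); have lt_j := ltr_index (v, j).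
rewrite /= in lt_k lt_j.
have := index_ge0 (v, k); have := index_ge0 (v, j) => /= j_ge0 k_ge0.
(* The three summands solve both line equations up to scale, as coordinates [v], [v + 1] and
   [v - 1]. Their sum [d] normalises them, and is positive thanks to the middle one. *)
pose d : R := j%:R * k%:R + (q%:R - k%:R) * (q%:R - j%:R) + k%:R * (q%:R - j%:R).
have d_gt0 : 0 < d.
  by rewrite ltr_wpDr ?mulr_ge0 ?ltr_wpDl ?mulr_ge0 ?mulr_gt0 // ltW.
pose x : 'rV[R]_3 := d^-1 *: \row_i (if i == v then j%:R * k%:R
  else if i == v + 1 then (q%:R - k%:R) * (q%:R - j%:R)
  else k%:R * (q%:R - j%:R)).
have [n1 n2 n3] := ord3_neq v.
have x0 : x 0 v = d^-1 * (j%:R * k%:R) by rewrite !mxE eqxx.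
have x1 : x 0 (v + 1) = d^-1 * ((q%:R - k%:R) * (q%:R - j%:R)).
  by rewrite !mxE n1 eqxx.
have x2 : x 0 (v - 1) = d^-1 * (k%:R * (q%:R - j%:R)).
  by rewrite !mxE n2 [_ - 1 == _]eq_sym n3.
have x_simplex : simplex x.
  split=> [i|]; last by rewrite (sum_row3 v x) x0 x1 x2 -!mulrDr mulVf // gt_eqF.
  have := ltW d_gt0; rewrite -invr_ge0 => d_ge0.
  by case: (ord3_cases v i) => ->; rewrite ?x0 ?x1 ?x2 !mulr_ge0 // ltW.
exists x; split => //; rewrite /lform /= ?addrK ?ord3_add2 ?x0 ?x1 ?x2; ring.
Qed.

Lemma incident_exists s t : exists2 x, incident s x & incident t x.
Proof.
case: (ord3_cases s.1 t.1) => e.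
- by exists (vertex s.1); apply/incident_vertex; left.
- exact: incident_exists_next.
- have [|x tx sx] := @incident_exists_next t s; first by rewrite e subrK.
  by exists x.
Qed.

End Incidence.

(** * Concurrent triples of segments *)

(* The segments through the vertex [v]: besides those starting at [v], the side
   from [v - 1] to [v]. *)
Definition star (q : nat) (v : 'I_3) : {set segment_index q} :=
  [set s : segment_index q | (s.1 == v) || (s.1 == v - 1) && (s.2 == 0%N :> nat)]%SET.

Lemma card_star q v : (0 < q)%N -> #|star q v| = q.+1.
Proof.
move=> q_gt0; pose k0 := Ordinal q_gt0.
have -> : star q v = ((v - 1, k0) |: [set (v, k) | k in [set: 'I_q]])%SET.
  apply/setP => -[w k]; rewrite !inE /= xpair_eqE orbC; congr (_ || _).
  by apply/eqP/imsetP => [->|[k' _ [-> _]] //]; exists k; rewrite ?inE.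
rewrite cardsU1 card_imset; last by move=> k k' [].
rewrite cardsT card_ord; case: imsetP => // -[k _ [/eqP]].
by have [_ ->] := ord3_neq v.
Qed.

(** Two distinct vertices lie on only one common segment, the side joining them. *)
Lemma star_inter q v w s t : v != w -> s \in star q v -> s \in star q w ->
  t \in star q v -> t \in star q w -> s = t.
Proof.
case: s t => [s1 s2] [t1 t2]; rewrite !inE /=.
have [n1 n2 n3] := ord3_neq v; have n3' : (v - 1 == v + 1) = false by rewrite eq_sym.
have n1' : (v == v + 1) = false by rewrite eq_sym.
have n2' : (v == v - 1) = false by rewrite eq_sym.
case: (ord3_cases v w) => ->; rewrite ?eqxx // => _; rewrite ?addrK ?ord3_sub2.
  case/orP => [/eqP->|/andP[/eqP-> _]]; rewrite ?n1' ?n3' ?n2 ?eqxx //=.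
  move=> /eqP s0.
  case/orP => [/eqP->|/andP[/eqP-> _]]; rewrite ?n1' ?n3' ?n2 ?eqxx //=.
  by move=> /eqP t0; congr (_, _); apply/val_inj; rewrite /= s0 t0.
case/orP => [/eqP->|/andP[/eqP-> /eqP s0]]; rewrite ?n1' ?n3' ?n2' ?eqxx //= => _.
case/orP => [/eqP->|/andP[/eqP-> /eqP t0]]; rewrite ?n1' ?n3' ?n2' ?eqxx //=.
by move=> _; congr (_, _); apply/val_inj; rewrite /= s0 t0.
Qed.

Definition ceva_set (q : nat) (t : 'I_q * 'I_q * 'I_q)
    : {set segment_index q} :=
  [set (0, t.1.1); (1, t.1.2); (- 1, t.2)]%SET.

Lemma ceva_set_inj q : injective (@ceva_set q).
Proof.
move=> [[i j] k] [[i' j'] k'] /setP e.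
have := e (0, i); have := e (1, j); have := e (- 1, k).
by rewrite !inE !eqxx ?orbT /= !xpair_eqE /= ?orbF =>
  /esym/eqP-> /esym/eqP-> /esym/eqP->.
Qed.

Definition concurrent (R : realType) q (T : {set segment_index q}) : Prop :=
  exists x : 'rV[R]_3, forall s, s \in T -> incident s x.

(** This is Ceva's theorem. Multiplying the three line equations gives the condition once the
    coordinates are cancelled. Conversely, the first two segments meet, and the condition turns
    their equations into the third. *)
Lemma concurrent_ceva (R : realType) q (t : 'I_q * 'I_q * 'I_q) :
  concurrent R (ceva_set t) <-> t \in ceva_triples q.
Proof.
case: t => [[k j] i]; rewrite inE /=.
have lt_k := ltr_index R (0 : 'I_3, k); have lt_j := ltr_index R (0 : 'I_3, j).
have lt_i := ltr_index R (0 : 'I_3, i); rewrite /= in lt_k lt_j lt_i.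
have -> : (k * j * i == (q - k) * (q - j) * (q - i))%N =
  (k%:R * j%:R * i%:R == (q%:R - k%:R) * (q%:R - j%:R) * (q%:R - i%:R) :> R).
  by rewrite -!natrB ?(ltnW (ltn_ord _)) // -!natrM eqr_nat.
have p1 : (1 : 'I_3) + 1 = - 1 by apply/val_inj.
have p2 : (- 1 : 'I_3) - 1 = 1 by apply/val_inj.
split=> [[x inc]|/eqP ceva].
  have [[_ sx] e0] : incident (0, k) x by apply: inc; rewrite !inE eqxx.
  have [_ e1] : incident (1, j) x by apply: inc; rewrite !inE eqxx ?orbT.
  have [_ e2] : incident (- 1, i) x by apply: inc; rewrite !inE eqxx ?orbT.
  move: e0 e1 e2 sx; rewrite (sum_row3 0) /lform /= !add0r p1 p2 subrr addNr.
  move: (x 0 0) (x 0 1) (x 0 (- 1)) => a b c.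
  move: (k%:R : R) (j%:R : R) (i%:R : R) (q%:R : R) lt_k lt_j lt_i.
  move=> K J I Q lt_k lt_j lt_i.
  move=> /subr0_eq e0 /subr0_eq e1 /subr0_eq e2 sx.
  (* A zero coordinate would propagate cyclically to all three, contradicting their sum [1]. *)
  have zero (d y z w : R) : 0 < d -> y * z = d * w -> z = 0 -> w = 0.
    move=> d_gt0 + z0; rewrite z0 mulr0 => /esym/eqP.
    by rewrite mulf_eq0 gt_eqF //= => /eqP.
  have bc := zero _ _ _ _ lt_k e0; have ca := zero _ _ _ _ lt_j e1.
  have ab := zero _ _ _ _ lt_i e2.
  have b_neq0 : b != 0.
    by apply/eqP => b0; move: sx; rewrite b0 (bc b0) (ca (bc b0)) !addr0 => /eqP;
      rewrite eq_sym oner_eq0.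
  have a_neq0 : a != 0 by apply: contra b_neq0 => /eqP/ab ->.
  have c_neq0 : c != 0 by apply: contra a_neq0 => /eqP/ca ->.
  apply/eqP/(mulIf (mulf_neq0 (mulf_neq0 b_neq0 c_neq0) a_neq0)).
  have -> : K * J * I * (b * c * a) = (K * b) * (J * c) * (I * a) by ring.
  by rewrite e0 e1 e2; ring.
have [x [sx e0] [_ e1]] := incident_exists R (0, k) (1, j).
exists x => s; rewrite !inE -orbA => /or3P[] /eqP-> //.
split=> //; move: e0 e1; rewrite /lform /= !add0r p1 p2 subrr addNr.
move=> /subr0_eq e0 /subr0_eq e1.
apply/(mulfI (x := (q%:R - k%:R) * (q%:R - j%:R))).
  by rewrite mulf_neq0 ?gt_eqF.
rewrite mulr0 mulrBr [X in _ - X]mulrA -ceva.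
have -> : (q%:R - k%:R) * (q%:R - j%:R) * (i%:R * x 0 0) =
  i%:R * ((q%:R - k%:R) * ((q%:R - j%:R) * x 0 0)) by ring.
rewrite -e1 -[_ * (j%:R * _)]mulrCA -e0.
by ring.
Qed.

Lemma concurrent_vertex (R : realType) q (T : {set segment_index q}) v :
  T \subset star q v -> concurrent R T.
Proof.
move=> /fintype.subsetP sub; exists (vertex R v) => s /sub; rewrite inE => sv.
apply/incident_vertex; case/orP: sv => [/eqP|/andP[/eqP ? /eqP]]; first by left.
by right.
Qed.

(** If the common point is a vertex, all three segments lie in its star. Otherwise no two of them
    start at the same vertex, so there is exactly one from each and Ceva's theorem applies. *)
Lemma concurrentP (R : realType) q (T : {set segment_index q}) : #|T| = 3%N ->
  concurrent R T <-> (exists v, T \subset star q v) \/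
                     T \in [set ceva_set t | t in ceva_triples q]%SET.
Proof.
move=> T3; split=> [[x inc]|[[v]|/imsetP[t]]]; last 2 first.
- exact: concurrent_vertex.
- by move=> /(concurrent_ceva R) + ->.
have [[v xv]|not_vertex] := pselect (exists v, x = vertex R v).
  left; exists v; apply/fintype.subsetP => s /inc; rewrite xv => /incident_vertex.
  by rewrite inE => -[->|[-> ->]]; rewrite ?eqxx ?orbT.
right; have inj_fst : {in T &, injective fst}.
  move=> s t /inc sx /inc tx e; apply: contrapT => neq; apply: not_vertex.
  by exists s.1; apply: incident_same sx tx.
have fstT : (fst @: T = [set: 'I_3])%SET.
  by apply/eqP; rewrite eqEcard finset.subsetT cardsT card_ord card_in_imset ?T3.
have memT v : exists k, (v, k) \in T.
  have : v \in (fst @: T)%SET by rewrite fstT inE.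
  by case/imsetP => -[w k] ? /= ->; exists k.
have [i iT] := memT 0; have [j jT] := memT 1; have [k kT] := memT (- 1).
have def_T : T = ceva_set (i, j, k).
  apply/eqP; rewrite eq_sym eqEcard; apply/andP; split.
    by apply/fintype.subsetP => s; rewrite !inE -orbA => /or3P[]/eqP->.
  by rewrite T3 /ceva_set -finset.setUA !cardsU1 cards1 !inE.
apply/imsetP; exists (i, j, k) => //; apply/(concurrent_ceva R).
by rewrite -def_T; exists x.
Qed.

(** * Counting the triples without a common point *)

Definition proper_triples (q : nat) : {set {set segment_index q}} :=
  ([set T : {set segment_index q} | #|T| == 3%N] :\:
   ((\bigcup_v [set T : {set segment_index q} | T \subset star q v & #|T| == 3%N])
    :|: [set ceva_set t | t in ceva_triples q]))%SET.

(** The concurrent triples are removed by kind in [proper_triples], which makes it a finite set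
    described without real numbers. This is its geometric meaning. *)
Lemma proper_triplesP (R : realType) q (T : {set segment_index q}) :
  T \in proper_triples q <-> #|T| = 3%N /\ ~ concurrent R T.
Proof.
rewrite finset.in_setD [X in _ && X]inE; split.
  case/andP => + /eqP T3; rewrite inE negb_or => /andP[nstar nceva].
  split=> // /(concurrentP R T3)[[v Tv]|]; last exact/negP.
  by case/negP: nstar; apply/finset.bigcupP; exists v; rewrite // inE Tv T3.
case=> T3 nconc; rewrite T3 eqxx andbT; apply/negP => bad; apply: nconc.
apply/(concurrentP R T3); move: bad; rewrite inE => /orP[/finset.bigcupP[v _]|];
  last by right.
by rewrite inE => /andP[Tv _]; left; exists v.
Qed.

Lemma card_ceva_set q (t : 'I_q * 'I_q * 'I_q) : #|ceva_set t| = 3%N.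
Proof. by rewrite /ceva_set -finset.setUA !cardsU1 cards1 !inE. Qed.

(** The removed families are pairwise disjoint. Two stars share at most one segment. A star contains
    no Ceva triple, since its members with positive index all start at the same vertex. *)
Lemma card_proper_triples q : (0 < q)%N ->
  (3 * 'C(q.+1, 3) + #|ceva_triples q| + #|proper_triples q| =
   'C(3 * q, 3))%N.
Proof.
move=> q_gt0.
pose D v := [set T : {set segment_index q} | T \subset star q v & #|T| == 3%N]%SET.
have cardD v : #|D v| = 'C(q.+1, 3) by rewrite cards_draws card_star.
have disjD v w : v != w -> (D v :&: D w = finset.set0)%SET.
  move=> vw; apply/setP => T; rewrite !inE; apply/negP.
  case/andP => /andP[/fintype.subsetP Tv T3] /andP[/fintype.subsetP Tw _].
  suff: (#|T| <= 1)%N by rewrite (eqP T3).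
  apply/card_le1_eqP => s t sT tT.
  by apply: (star_inter vw); [exact: Tv|exact: Tw|exact: Tv|exact: Tw].
have disjC v : (D v :&: [set ceva_set t | t in ceva_triples q] = finset.set0)%SET.
  apply/setP => T; rewrite !inE; apply/negP => /andP[/andP[/fintype.subsetP Tv _]].
  case/imsetP => t /ceva_triple_gt0[gt1 gt2 gt3] def_T.
  have mem s : s \in T -> (0 < s.2)%N -> s.1 = v.
    by move=> /Tv; rewrite inE => /orP[/eqP //|/andP[_ /eqP->]].
  have := mem (0, t.1.1); have := mem (1, t.1.2).
  rewrite def_T !inE !eqxx !orbT => h1 h0.
  by have := h1 isT gt2; rewrite -(h0 isT gt1).
have disjU : ((\bigcup_v D v) :&: [set ceva_set t | t in ceva_triples q] =
    finset.set0)%SET.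
  by rewrite big_distrl big1 //= => v _; exact: disjC.
have -> : (3 * 'C(q.+1, 3) + #|ceva_triples q|)%N =
    #|((\bigcup_v D v) :|: [set ceva_set t | t in ceva_triples q])%SET|.
  rewrite cardsU disjU cards0 subn0 (card_imset _ (@ceva_set_inj q)); congr (_ + _)%N.
  rewrite !big_ord_recl big_ord0 finset.setU0 !cardsU finset.setIUr
    !disjD // finset.setU0.
  by rewrite !cards0 !subn0 !cardD; lia.
have -> : 'C(3 * q, 3) = #|[set T : {set segment_index q} | #|T| == 3%N]%SET|.
  by rewrite card_draws card_prod !card_ord.
rewrite -[RHS](cardsID ((\bigcup_v D v) :|: [set ceva_set t | t in ceva_triples q])%SET).
congr (_ + _)%N; apply/eq_card => T; rewrite !inE andbC.
apply/esym/andb_idr => /orP[/finset.bigcupP[v _]|/imsetP[t _ ->]].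
  by rewrite inE => /andP[].
by rewrite card_ceva_set.
Qed.

Lemma bin3 n : ('C(n.+2, 3) * 6 = n.+2 * n.+1 * n)%N.
Proof. by rewrite (bin_ffact n.+2 3) !ffactnS ffactn0 /=; lia. Qed.

(** Doubling avoids fractions: [2 C(3 q, 3) = 9 q^3 - 9 q^2 + 2 q] and [6 C(q + 1, 3) = q^3 - q]. *)
Lemma card_proper_triples_double q : (1 < q)%N ->
  (2 * #|proper_triples q| + 2 * #|ceva_triples q| =
   8 * q ^ 3 - 9 * q ^ 2 + 3 * q)%N.
Proof.
case: q => [|[|n]] // _; have := @card_proper_triples n.+2 isT.
have := bin3 n.+1; have := bin3 (3 * n + 4).
have -> : (3 * n + 4).+2 = (3 * n.+2)%N by lia.
move: 'C(_, _) 'C(_, _) => c d; nia.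
Qed.

(** * Triangles in the plane *)

Lemma card_eq_finset (T : finType) (F : {set T}) :
  [set x | x \in F] #= `I_#|F|.
Proof.
have -> : `I_#|F| = [set index x (enum F) | x in [set x | x \in F]].
  apply/seteqP; split=> [k /= lt_k|_ [x /= Fx <-]].
    have [x0 _] : exists x, x \in F by apply/card_gt0P; apply: leq_ltn_trans lt_k.
    rewrite cardE in lt_k; exists (nth x0 (enum F) k).
      by rewrite /= -mem_enum mem_nth.
    by rewrite index_uniq ?enum_uniq.
  by rewrite /= cardE index_mem mem_enum.
rewrite card_eq_sym; apply: inj_card_eq => x y; rewrite !inE /= => Fx Fy.
by apply: (index_inj x); rewrite mem_enum.
Qed.

Lemma cards3P (T : finType) (A : {set T}) : #|A| = 3%N ->
  exists s t u, [/\ s <> t, t <> u, u <> s & A = [set s; t; u]%SET].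
Proof.
move=> A3; have [s sA] : exists s, s \in A by apply/card_gt0P; rewrite A3.
have /cards2P[t [u [tu def_A]]] : (#|A :\ s| == 2)%N.
  by move: A3; rewrite (cardsD1 s) sA add1n => -[e]; rewrite e.
have : s \notin (A :\ s)%SET by rewrite !inE eqxx.
rewrite def_A !inE negb_or => /andP[/eqP st /eqP su].
exists s, t, u; split=> //; [exact/eqP|exact: nesym|].
by rewrite -(finset.setD1K sA) def_A finset.setUA.
Qed.

Lemma noncollinearP (R : realType) (P Q S : 'rV[R]_2) : noncollinear P Q S <->
  forall a b, a *: (Q - P) + b *: (S - P) = 0 -> a = 0 /\ b = 0.
Proof.
rewrite /noncollinear; split.
  move=> /(freeP (X := [tuple Q - P; S - P])) h a b e.
  pose k (i : 'I_2) := if i == 0 then a else b.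
  have := h k; rewrite !big_ord_recl big_ord0 addr0 /= => /(_ e) k0.
  by split; [exact: (k0 0)|exact: (k0 1)].
move=> h; apply/(freeP (X := [tuple Q - P; S - P])) => k.
rewrite !big_ord_recl big_ord0 addr0 /= => /h[k0 k1] i.
by case: i => [[|[|//]] ?]; [rewrite -k0|rewrite -k1]; congr (k _); apply/val_inj.
Qed.

Lemma convex_combination (R : realType) q (s : segment_index q) (x y : 'rV[R]_3) t :
  0 <= t <= 1 -> incident s x -> incident s y ->
  incident s ((1 - t) *: x + t *: y).
Proof.
move=> /andP[t0 t1] [[x0 sx] ex] [[y0 sy] ey]; split; last first.
  by rewrite lformD !lformZ ex ey !mulr0 addr0.
split=> [v|]; first by rewrite !mxE addr_ge0 // mulr_ge0 // subr_ge0.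
under eq_bigr do rewrite !mxE.
by rewrite big_split /= -!mulr_sumr sx sy !mulr1 subrK.
Qed.

Section Drawing.
Variables (R : realType) (q : nat) (M : 'M[R]_(3, 2)).
(** The rows of [M] are the vertices of the triangle. The hypothesis is their affine independence,
    which makes barycentric coordinates unique. *)
Hypothesis affine_free :
  forall x : 'rV[R]_3, \sum_v x 0 v = 0 -> x *m M = 0 -> x = 0.
Implicit Types (s t u : segment_index q) (x y z : 'rV[R]_3).
Implicit Types (T : {set segment_index q}).

Definition drawn s : set 'rV[R]_2 := [set x *m M | x in incident s].

Lemma mulmx_simplex_inj x y : simplex x -> simplex y -> x *m M = y *m M -> x = y.
Proof.
move=> [_ sx] [_ sy] e; apply/subr0_eq/affine_free.
  by under eq_bigr do rewrite !mxE; rewrite big_split sumrN /= sx sy subrr.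
by rewrite mulmxBl e subrr.
Qed.

Lemma drawn_mulmx s x : simplex x -> drawn s (x *m M) <-> incident s x.
Proof.
move=> sx; split=> [[y sy e]|?]; last by exists x.
by rewrite -(mulmx_simplex_inj (proj1 sy) sx e).
Qed.

Lemma drawn_setI s t x : s <> t -> incident s x -> incident t x ->
  drawn s `&` drawn t = [set x *m M].
Proof.
move=> neq sx tx; apply/seteqP; split=> [_ [[y sy <-]]|_ ->] /=.
  move=> /(drawn_mulmx t (proj1 sy)) ty.
  by rewrite (incident_unique neq sy ty sx tx).
by split; exists x.
Qed.

Lemma segment_sub_drawn s x y : incident s x -> incident s y ->
  segment (x *m M) (y *m M) `<=` drawn s.
Proof.
move=> sx sy _ [t t01 <-]; exists ((1 - t) *: x + t *: y).
  exact: convex_combination.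
by rewrite mulmxDl !scalemxAl.
Qed.

Definition corners T : set 'rV[R]_3 :=
  [set x | exists s t, [/\ s \in T, t \in T, s <> t, incident s x & incident t x]].

Definition corner_points T : set 'rV[R]_2 := [set x *m M | x in corners T].

Lemma corners_set3 s t u x y z : s <> t -> t <> u -> u <> s ->
  incident t x -> incident u x -> incident u y -> incident s y ->
  incident s z -> incident t z -> corners [set s; t; u]%SET = [set x; y; z].
Proof.
move=> st tu us tx ux uy sy sz tz; apply/seteqP; split=> w /=.
  case=> a [b []]; rewrite !inE -!orbA.
  by move=> /or3P[]/eqP-> /or3P[]/eqP-> // _ ha hb;
    do ?[by left; left; apply: (incident_unique tu)
        |by left; right; apply: (incident_unique us)
        |by right; apply: (incident_unique st)].
have [sT tT uT] : [/\ s \in [set s; t; u]%SET, t \in [set s; t; u]%SET &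
  u \in [set s; t; u]%SET] by rewrite !inE !eqxx !orbT.
by move=> [[->|->]|->]; [exists t, u|exists u, s|exists s, t].
Qed.

Lemma corner_points_set3 s t u x y z : s <> t -> t <> u -> u <> s ->
  incident t x -> incident u x -> incident u y -> incident s y ->
  incident s z -> incident t z ->
  corner_points [set s; t; u]%SET = [set x *m M; y *m M; z *m M].
Proof.
move=> st tu us tx ux uy sy sz tz.
rewrite /corner_points (corners_set3 st tu us tx ux uy sy sz tz).
by rewrite !image_setU !image_set1.
Qed.

(** A linear relation between the edge vectors lifts to barycentric coordinates. The form of [t]
    vanishes at [x] and [z] but not at [y], which gives [a = 0]; the form of [u] likewise gives
    [b = 0]. *)
Lemma proper_triple_noncollinear s t u x y z :
  ~ concurrent R [set s; t; u]%SET ->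
  incident t x -> incident u x -> incident u y -> incident s y ->
  incident s z -> incident t z -> noncollinear (x *m M) (y *m M) (z *m M).
Proof.
move=> nconc tx ux uy sy sz tz.
have not_inc (w : 'rV[R]_3) : incident s w -> incident t w -> incident u w -> False.
  by move=> sw tw uw; apply: nconc; exists w => r; rewrite !inE -orbA => /or3P[]/eqP->.
apply/noncollinearP => a b; rewrite -!mulmxBl !scalemxAl -mulmxDl => e.
have {}e : a *: (y - x) + b *: (z - x) = 0.
  apply: affine_free => //; under eq_bigr do rewrite !mxE.
  rewrite big_split -!mulr_sumr !big_split !sumrN /=.
  by rewrite (tx.1.2) (uy.1.2) (sz.1.2) subrr !mulr0 addr0.
have eval (r : segment_index q) :
    a * (lform r y - lform r x) + b * (lform r z - lform r x) = 0.
  rewrite -!lformB -!lformZ -lformD e /lform !mxE; ring.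
split; apply/eqP.
  have := eval t; rewrite tx.2 tz.2 !subr0 mulr0 addr0 => /eqP.
  rewrite mulf_eq0 => /orP[//|/eqP ty].
  by case: (not_inc y) => //; split=> //; exact: uy.1.
have := eval u; rewrite ux.2 uy.2 !subr0 mulr0 add0r => /eqP.
rewrite mulf_eq0 => /orP[//|/eqP uz].
by case: (not_inc z) => //; split=> //; exact: sz.1.
Qed.

(** Noncollinear vertices are distinct. If two of the segments were equal, their one-point
    intersection would be a whole segment containing two vertices; a point common to all three would
    make the vertices coincide. *)
Lemma bounds_triangle_proper s t u P Q S :
  bounds_triangle (drawn s) (drawn t) (drawn u) P Q S ->
  [set s; t; u]%SET \in proper_triples q /\
  [set P; Q; S] = corner_points [set s; t; u]%SET.
Proof.
move=> [/noncollinearP ncol [tuP usQ stS] _].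
have PQ : P <> Q.
  move=> e; have [|/eqP] := ncol 1 0; last by rewrite oner_eq0.
  by rewrite e subrr scaler0 scale0r addr0.
have PS : P <> S.
  move=> e; have [|_ /eqP] := ncol 0 1; last by rewrite oner_eq0.
  by rewrite e subrr scaler0 scale0r addr0.
have QS : Q <> S.
  move=> e; have [|/eqP] := ncol 1 (- 1); last by rewrite oner_eq0.
  by rewrite e scaleN1r scale1r subrr.
have [tP uP] : (drawn t `&` drawn u) P by rewrite tuP.
have [uQ sQ] : (drawn u `&` drawn s) Q by rewrite usQ.
have [sS tS] : (drawn s `&` drawn t) S by rewrite stS.
have st : s <> t.
  by move=> e; apply: PS; have : [set S] P; [rewrite -stS e|].
have tu : t <> u.
  by move=> e; apply: PQ; have : [set P] Q; [rewrite -tuP e|move=> ->].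
have us : u <> s.
  by move=> e; apply: QS; have : [set Q] S; [rewrite -usQ e|move=> ->].
case: tP => x tx def_P; have ux : incident u x.
  by apply/drawn_mulmx; [exact: tx.1|rewrite def_P].
case: uQ => y uy def_Q; have sy : incident s y.
  by apply/drawn_mulmx; [exact: uy.1|rewrite def_Q].
case: sS => z sz def_S; have tz : incident t z.
  by apply/drawn_mulmx; [exact: sz.1|rewrite def_S].
split; last by rewrite (corner_points_set3 st tu us tx ux uy sy sz tz) def_P def_Q def_S.
apply/(proper_triplesP R); split.
  by rewrite -finset.setUA !cardsU1 cards1 !inE !negb_or; move/eqP: st;
    move/eqP: tu; move/eqP: us; rewrite [u == s]eq_sym => -> -> ->.
move=> [w inc]; have [sw tw uw] : [/\ incident s w, incident t w & incident u w].
  by split; apply: inc; rewrite !inE eqxx ?orbT.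
apply: PQ; rewrite -def_P -def_Q.
by rewrite (incident_unique tu tx ux tw uw) (incident_unique us uy sy uw sw).
Qed.

Lemma proper_triple_bounds T : T \in proper_triples q ->
  exists s t u P Q S, bounds_triangle (drawn s) (drawn t) (drawn u) P Q S /\
    corner_points T = [set P; Q; S].
Proof.
move=> /(proper_triplesP R)[/cards3P[s [t [u [st tu us ->]]]] nconc].
have [x tx ux] := incident_exists R t u; have [y uy sy] := incident_exists R u s.
have [z sz tz] := incident_exists R s t.
exists s, t, u, (x *m M), (y *m M), (z *m M); split; last first.
  exact: corner_points_set3.
split; first exact: proper_triple_noncollinear nconc tx ux uy sy sz tz.
- by split; apply: drawn_setI.
- by split; apply: segment_sub_drawn.
Qed.

(* A proper triple is recovered from its corners: its members are the segments
   through two distinct corners. *)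
Lemma corner_points_inj :
  {in [set T | T \in proper_triples q] &, injective corner_points}.
Proof.
have memE T r : T \in proper_triples q -> r \in T <->
    exists x y, [/\ corners T x, corners T y, x <> y, incident r x & incident r y].
  move=> /(proper_triplesP R)[T3 nconc]; split.
    move=> rT; have [s [t [u [st tu us def_T]]]] := cards3P T3.
    (* A member meets the other two in different points, for otherwise the triple would be
       concurrent. *)
    have key a b c : a <> b -> b <> c -> c <> a -> T = [set a; b; c]%SET ->
        exists x y, [/\ corners T x, corners T y, x <> y, incident a x & incident a y].
      move=> ab bc ca defT; have [x ax bx] := incident_exists R a b.
      have [y ay cy] := incident_exists R a c.
      have [aT bT cT] : [/\ a \in T, b \in T & c \in T].
        by rewrite defT !inE !eqxx !orbT.
      exists x, y; split=> //; [by exists a, b|exists a, c; split=> //; exact/nesym|].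
      move=> xy; apply: nconc; exists x => d; rewrite defT !inE -orbA.
      by move=> /or3P[]/eqP-> //; rewrite xy.
    move: rT; rewrite def_T !inE -orbA => /or3P[]/eqP->; rewrite -def_T.
    - exact: (key s t u).
    - apply: (key t u s) => //; rewrite def_T.
      by rewrite -finset.setUA finset.setUC.
    - apply: (key u s t) => //; rewrite def_T.
      by rewrite finset.setUC finset.setUA.
  case=> x [y [[a [b [aT bT ab ax bx]]] [c [d [cT dT cd cy dy]]] xy rx ry]].
  (* Each corner lies on two of the three members, so by the pigeonhole principle some member [e]
     contains both. Distinct segments meet only once, hence [r = e]. *)
  have [e eT [ex ey]] : exists2 e, e \in T & incident e x /\ incident e y.
    have [|n1] := eqVneq a c; first by move=> e; exists a => //; split=> //; rewrite e.
    have [|n2] := eqVneq a d; first by move=> e; exists a => //; split=> //; rewrite e.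
    have [|n3] := eqVneq b c; first by move=> e; exists b => //; split=> //; rewrite e.
    have [|n4] := eqVneq b d; first by move=> e; exists b => //; split=> //; rewrite e.
    have : (#|[set a; b; c; d]%SET| <= #|T|)%N.
      apply/subset_leq_card/fintype.subsetP => r'; rewrite !inE -!orbA.
      by move=> /or4P[]/eqP->.
    rewrite T3 -!finset.setUA !cardsU1 cards1 !inE !negb_or n1 n2 n3 n4.
    by move/eqP: ab => ->; move/eqP: cd => ->.
  suff -> : r = e by [].
  by apply: contrapT => re; apply: xy; apply: (incident_unique re).
have cornersE T x : simplex x -> corners T x <-> corner_points T (x *m M).
  move=> sx; split=> [?|[y [s [t [sT tT st sy ty]]] e]]; first by exists x.
  by rewrite -(mulmx_simplex_inj (proj1 sy) sx e); exists s, t.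
have sub T T' r : T \in proper_triples q -> T' \in proper_triples q ->
    corner_points T = corner_points T' -> r \in T -> r \in T'.
  move=> pT pT' e /(memE _ _ pT)[x [y [Tx Ty xy rx ry]]]; apply/(memE _ _ pT').
  have transfer z : simplex z -> corners T z -> corners T' z.
    by move=> sz /(cornersE _ _ sz); rewrite e => /(cornersE _ _ sz).
  by exists x, y; split=> //; apply: transfer => //; [exact: rx.1|exact: ry.1].
move=> T T'; rewrite !inE => pT pT' e; apply/setP => r.
by apply/idP/idP; apply: sub.
Qed.

End Drawing.

(** * The given triangle in barycentric coordinates, and the final count *)

Definition vertex_matrix (R : realType) (A B C : 'rV[R]_2) : 'M[R]_(3, 2) :=
  \matrix_v tnth [tuple A; B; C] v.

Lemma mul_vertex_matrix (R : realType) (A B C : 'rV[R]_2) (x : 'rV[R]_3) v :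
  let V := tnth [tuple A; B; C] in
  x *m vertex_matrix A B C =
  x 0 v *: V v + x 0 (v + 1) *: V (v + 1) + x 0 (v - 1) *: V (v - 1).
Proof. by rewrite mulmx_sum_row (sum_ord3 _ v) !rowK. Qed.

Lemma vertex_matrix_affine_free (R : realType) (A B C : 'rV[R]_2) :
  noncollinear A B C ->
  forall x : 'rV[R]_3, \sum_v x 0 v = 0 -> x *m vertex_matrix A B C = 0 -> x = 0.
Proof.
move=> /noncollinearP ncol x; rewrite (mul_vertex_matrix _ _ _ _ 0) (sum_row3 0).
have -> : tnth [tuple A; B; C] 0 = A by [].
have -> : tnth [tuple A; B; C] (0 + 1) = B by [].
have -> : tnth [tuple A; B; C] (0 - 1) = C by [].
move=> sx e; have x0 : x 0 0 = - x 0 (0 + 1) - x 0 (0 - 1) by lra.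
have [|x1 x2] := ncol (x 0 (0 + 1)) (x 0 (0 - 1)).
  by rewrite -e x0; apply/rowP => i; rewrite !mxE; ring.
by apply: (row3P (v := 0)); rewrite !mxE ?x0 ?x1 ?x2 ?oppr0 ?addr0.
Qed.

(** With [c = k / q], the point at parameter [t] has coordinates [1 - t], [t (1 - c)] and [t c]. The
    equation of the segment expresses the fixed ratio of the last two, and [t] is recovered as their
    sum. *)
Lemma drawnE (R : realType) q (A B C : 'rV[R]_2) v (k : 'I_q) :
  let V := tnth [tuple A; B; C] in
  drawn (vertex_matrix A B C) (v, k) =
  segment (V v) (division_point q (V (v + 1)) (V (v - 1)) k).
Proof.
move=> V; have q_gt0 : 0 < q%:R :> R by rewrite ltr0n (leq_ltn_trans _ (ltn_ord k)).
have lt_k := ltr_index R (v, k); rewrite /= in lt_k.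
have k_ge0 : 0 <= k%:R :> R := ler0n _ _.
pose c : R := k%:R / q%:R.
have def_k : k%:R = c * q%:R by rewrite mulfVK // gt_eqF.
have c_ge0 : 0 <= c by rewrite divr_ge0 // ltW.
have c_le1 : c <= 1 by rewrite ler_pdivrMr // mul1r -subr_ge0 ltW.
have comb t : (1 - t) *: V v + t *: division_point q (V (v + 1)) (V (v - 1)) k =
    (1 - t) *: V v + (t * (1 - c)) *: V (v + 1) + (t * c) *: V (v - 1).
  by rewrite /division_point -/c; apply/rowP => i; rewrite !mxE; ring.
apply/seteqP; split=> [_ [x [[x0 sx] ex] <-]|_ [t /= /andP[t0 t1] <-]].
  rewrite (sum_row3 v) in sx; have x1 := x0 (v + 1); have x2 := x0 (v - 1).
  exists (x 0 (v + 1) + x 0 (v - 1)).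
    by have xv := x0 v; apply/andP; split; lra.
  have e2 : x 0 (v - 1) = (x 0 (v + 1) + x 0 (v - 1)) * c.
    apply: (mulIf (x := q%:R)); first by rewrite gt_eqF.
    by move: ex; rewrite /lform /= -mulrA -def_k => ex; lra.
  rewrite comb (mul_vertex_matrix _ _ _ _ v) -/V; congr (_ *: _ + _ *: _ + _ *: _); lra.
have [n1 n2 n3] := ord3_neq v.
pose x : 'rV[R]_3 := \row_i (if i == v then 1 - t else
  if i == v + 1 then t * (1 - c) else t * c).
have xv : x 0 v = 1 - t by rewrite mxE eqxx.
have x1 : x 0 (v + 1) = t * (1 - c) by rewrite mxE n1 eqxx.
have x2 : x 0 (v - 1) = t * c by rewrite mxE n2 [_ - 1 == _]eq_sym n3.
exists x; last by rewrite comb (mul_vertex_matrix _ _ _ _ v) xv x1 x2.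
split; last by rewrite /lform /= x1 x2 def_k; ring.
split=> [i|]; last by rewrite (sum_row3 v) xv x1 x2; ring.
case: (ord3_cases v i) => ->; rewrite ?xv ?x1 ?x2 ?subr_ge0 //.
  by rewrite mulr_ge0 // subr_ge0.
by rewrite mulr_ge0.
Qed.

Lemma drawn_segmentsE (R : realType) q (A B C : 'rV[R]_2) : (0 < q)%N ->
  drawn_segments q A B C = range (@drawn R q (vertex_matrix A B C)).
Proof.
move=> q_gt0; pose k0 := Ordinal q_gt0.
pose V := tnth [tuple A; B; C].
have side v : drawn (vertex_matrix A B C) (v, k0) = segment (V v) (V (v + 1)).
  by rewrite drawnE /division_point /= mul0r scale0r addr0.
have cev v : cevians q (V v) (V (v + 1)) (V (v - 1)) `<=`
    range (@drawn R q (vertex_matrix A B C)).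
  by move=> _ [k /= /andP[_ lt_k] <-]; exists (v, Ordinal lt_k); rewrite // drawnE.
apply/seteqP; split=> [a|_ [[v k] _ <-]].
  case=> [[[->|->]|->]|[[|]|]].
  - by exists (0, k0); rewrite // side.
  - by exists (1, k0); rewrite // side.
  - by exists (- 1, k0); rewrite // side.
  - exact: (cev 0).
  - exact: (cev 1).
  - exact: (cev (- 1)).
(* Index [0] yields the three sides, once each; positive indices yield the cevians. *)
have [k_eq|k_neq] := eqVneq k k0.
  rewrite k_eq side; left.
  by case: (ord3_cases 0 v) => ->; [left; left|left; right|right].
have k_gt0 : (0 < k)%N by rewrite lt0n.
right; rewrite drawnE; case: (ord3_cases 0 v) => ->.
- by left; left; exists k; rewrite //= k_gt0 /=.
- by left; right; exists k; rewrite //= k_gt0 /=.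
- by right; exists k; rewrite //= k_gt0 /=.
Qed.

(** Sending a proper triple of segments to its set of corners is a bijection onto the triangles. *)
Lemma triangles_formed_card (R : realType) q (A B C : 'rV[R]_2) : (0 < q)%N ->
  noncollinear A B C -> triangles_formed q A B C #= `I_#|proper_triples q|.
Proof.
move=> q_gt0 /vertex_matrix_affine_free free_M.
have -> : triangles_formed q A B C =
    [set corner_points (vertex_matrix A B C) T | T in
      [set T | T \in proper_triples q]].
  rewrite /triangles_formed drawn_segmentsE //; apply/seteqP; split=> T /=.
    move=> [_ [_ [_ [P [Q [S [[[s _ <-] [t _ <-] [u _ <-]]]]]]]]].
    move=> /(bounds_triangle_proper free_M)[pT e] ->.
    by exists [set s; t; u]%SET; rewrite // e.
  case=> T' /(proper_triple_bounds free_M)[s [t [u [P [Q [S [bd e]]]]]]] <-.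
  by exists (drawn (vertex_matrix A B C) s), (drawn (vertex_matrix A B C) t),
    (drawn (vertex_matrix A B C) u), P, Q, S; split=> //; split; eexists.
apply: card_eq_trans (card_eq_finset _); apply: inj_card_eq.
exact: corner_points_inj.
Qed.

Theorem theorem2 (R : realType) (p m q : nat) (A B C : 'rV[R]_2)
    (hp : prime p) (hm : (1 <= m)%N) (hq : q = (p ^ m)%N)
    (hABC : noncollinear A B C) :
  (odd p ->
     triangles_formed q A B C #= `I_((8 * q ^ 3 - 9 * q ^ 2 + 3 * q) %/ 2)%N) /\
  (p = 2%N ->
     triangles_formed q A B C
       #= `I_((8 * q ^ 3 - 9 * q ^ 2 - 3 * q + 10) %/ 2)%N).
Proof.
have q_gt1 : (1 < q)%N.
  by rewrite hq (leq_trans (prime_gt1 hp)) // -{1}(expn1 p) leq_pexp2l // prime_gt0.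
have double := card_proper_triples_double q_gt1.
have card := triangles_formed_card (ltnW q_gt1) hABC.
split=> [p_odd|p2].
  have no_ceva : #|ceva_triples q| = 0%N by rewrite hq card_ceva_odd.
  by rewrite -double no_ceva muln0 addn0 mulKn.
have ceva : #|ceva_triples q| = (3 * q - 5)%N by rewrite hq p2 card_ceva_two.
suff -> : (8 * q ^ 3 - 9 * q ^ 2 - 3 * q + 10 = 2 * #|proper_triples q|)%N.
  by rewrite mulKn.
(* Subtraction of natural numbers truncates, so the formula needs this bound, which holds from
   [q = 2] on. *)
have : (9 * q ^ 2 + 3 * q <= 8 * q ^ 3)%N by nia.
by move: double; rewrite ceva; lia.
Qed.
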